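(* For an integer $d$, let $\mathcal{AP}_{(1,1,1,d)}(\mathbb{Q})$ be the set of triples $(x,y,z)\in\mathbb{Z}^3$ with $y-x=z-y$ satisfying $x^2+y^2+z^2=dxyz$. Then $\mathcal{AP}_{(1,1,1,1)}(\mathbb{Q})=\{(0,0,0),(3,3,3),(-15,-6,3),(3,-6,-15)\}$, $\mathcal{AP}_{(1,1,1,3)}(\mathbb{Q})=\{(0,0,0),(1,1,1),(-5,-2,1),(1,-2,-5)\}$, and if $d$ is a positive integer with $d\neq 1,3$, then $\mathcal{AP}_{(1,1,1,d)}(\mathbb{Q})=\{(0,0,0)\}$. *)

(* Defs.v *)
From mathcomp Require Import all_boot all_order all_algebra.
From mathcomp Require Import classical_sets.

Set Implicit Arguments.
Unset Strict Implicit.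
Unset Printing Implicit Defensive.

Local Open Scope ring_scope.
Local Open Scope classical_set_scope.

(* AP_{(1,1,1,d)}(Q); the triples are in the ring of integers Z of Q. *)
Definition AP (d : int) : set (int * int * int) :=
  [set t | let: (x, y, z) := t in
           y - x = z - y /\ x ^+ 2 + y ^+ 2 + z ^+ 2 = d * x * y * z].

(* Main.v *)
Require Import Defs.
From mathcomp Require Import all_boot all_order all_algebra.
From mathcomp Require Import classical_sets zify ring.


Set Implicit Arguments.
Unset Strict Implicit.

Import Order.TTheory GRing.Theory Num.Theory.
Local Open Scope ring_scope.
Local Open Scope classical_set_scope.

(** Write the progression as [(y - k, y, y + k)] and put [m = d y].  The equation
    becomes [(m + 2) k^2 = (m - 3) y^2], so for [y <> 0] the integer
    [(m + 2) (m - 3)] is a rational square, hence a square [s^2].  Then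
    [(2 m - 1)^2 - (2 s)^2 = 25] leaves only [m = -6, -2, 3, 7], i.e. finitely
    many pairs [(d, y)]. *)

Lemma sqr_eq_mul_cases (m s : int) :
  s ^+ 2 = (m + 2) * (m - 3) -> m \in [:: -6; -2; 3; 7].
Proof.
wlog s_ge0 : s / 0 <= s.
  move=> IH Es; have [/IH|/ltW s_le0] := leP 0 s; first exact.
  by apply: (IH (- s)); rewrite ?sqrrN ?oppr_ge0.
rewrite expr2 !inE => Es.
(* Here [s ^+ 2 = m ^+ 2 - m - 6]. For [m > 0] this forces [s <= m - 1], and comparing squares gives
   [m <= 7]; for [m < 0] it forces [s <= - m], whence [m >= -6]. *)
have m_le7 : m <= 7.
  by have [|m_gt0] := leP m 0; [lia | have s_lt : s < m by [nia]; nia].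
have m_ge : -6 <= m.
  by have [|m_lt0] := leP 0 m; [lia | have s_le : s <= - m by [nia]; nia].
(* For [m] between -6 and 7 the product is at most 36, its value at both ends. *)
have s_le6 : s <= 6 by nia.
have : exists i : nat, s = i%:Z by exists `|s|%N; lia.
case=> i Ei; subst s.
by case: i s_le6 s_ge0 Es => [|[|[|[|[|[|[|i]]]]]]] ? ? Es; nia.
Qed.

Lemma dvdz_sqr (a b : int) : (a ^+ 2 %| b ^+ 2)%Z -> (a %| b)%Z.
Proof. by rewrite !dvdzE !abszX dvdn_pexp2r. Qed.

Lemma AP_center_mul (d y k : int) : y != 0 ->
  (d * y + 2) * k ^+ 2 = (d * y - 3) * y ^+ 2 ->
  d * y \in [:: -6; -2; 3; 7].
Proof.
(* The quotient of [t] by [y] is the required square root; it is an integer because [y ^+ 2] divides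
   [t ^+ 2]. *)
move=> y0 E; set t := (d * y + 2) * k.
have Et : t ^+ 2 = ((d * y + 2) * (d * y - 3)) * y ^+ 2.
  by rewrite -mulrA -E /t; ring.
have /dvdz_sqr/dvdzP[s Es] : (y ^+ 2 %| t ^+ 2)%Z by rewrite Et dvdz_mull.
apply: (@sqr_eq_mul_cases _ s); apply: (mulIf (expf_neq0 2 y0)).
by rewrite -Et Es exprMn.
Qed.

Lemma AP_cases (d x y z : int) : 0 < d -> AP d (x, y, z) ->
  [\/ (x, y, z) = (0, 0, 0),
      d = 1 /\ ([\/ (x, y, z) = (3, 3, 3), (x, y, z) = (-15, -6, 3)
                  | (x, y, z) = (3, -6, -15)]) |
      d = 3 /\ ([\/ (x, y, z) = (1, 1, 1), (x, y, z) = (-5, -2, 1)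
                  | (x, y, z) = (1, -2, -5)])].
Proof.
move=> d_gt0 [] Hap; set k : int := z - y.
have -> : x = y - k by rewrite /k; lia.
have -> : z = y + k by rewrite /k; lia.
move: k => k {x z Hap} Heq.
have E : (d * y + 2) * k ^+ 2 = (d * y - 3) * y ^+ 2.
  apply/eqP; rewrite -subr_eq0; apply/eqP.
  transitivity ((y - k) ^+ 2 + y ^+ 2 + (y + k) ^+ 2
                - d * (y - k) * y * (y + k)); last by rewrite Heq subrr.
  ring.
have [y0|y0] := eqVneq y 0.
  by constructor 1; have k0 : k = 0 by [nia]; rewrite y0 k0.
have := AP_center_mul y0 E; rewrite !inE.
case/or4P=> /eqP Edy; rewrite Edy in E.
(* Case [d * y = -6]: [E] becomes [4 k^2 = 9 y^2]. *)
- have d_le6 : d <= 6 by nia.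
  have k23 : 2 * k = 3 * y \/ 2 * k = - (3 * y).
    have /eqP : (2 * k) ^+ 2 = (3 * y) ^+ 2 by rewrite !exprMn; lia.
    by rewrite eqf_sqr => /orP[]/eqP; [left|right].
  (* By [k23], [y] is even, which rules out the divisors 2 and 6 of 6 as values of [d]. *)
  have : (d = 1 /\ y = -6) \/ (d = 3 /\ y = -2).
    have : d \in [:: 1; 2; 3; 4; 5; 6] by rewrite !inE; lia.
    rewrite !inE; do 5?case/orP; move=> /eqP Ed; rewrite Ed in Edy *; lia.
  case=> -[? ?]; subst d y; [constructor 2|constructor 3]; split=> //;
    case: k23 => Ek.
  + by constructor 3; congr (_, _, _); lia.
  + by constructor 2; congr (_, _, _); lia.
  + by constructor 3; congr (_, _, _); lia.
  + by constructor 2; congr (_, _, _); lia.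
(* Case [d * y = -2]: [E] becomes [0 = -5 y^2], against [y != 0]. *)
- nia.
(* Case [d * y = 3]: [E] becomes [5 k^2 = 0], so the progression is constant. *)
- have k0 : k = 0 by nia.
  have : (d = 1 /\ y = 3) \/ (d = 3 /\ y = 1).
    have : d \in [:: 1; 2; 3] by rewrite !inE; nia.
    by rewrite !inE => /or3P[]/eqP Ed; rewrite Ed in Edy *; lia.
  rewrite k0.
  by case=> -[-> ->]; [constructor 2|constructor 3]; split=> //; constructor.
(* Case [d * y = 7]: [E] becomes [9 k^2 = 4 y^2], so 3 divides [y] and hence 7, which is absurd. *)
- have [q Ey] : exists q, y = 3 * q.
    have /eqP : (3 * k) ^+ 2 = (2 * y) ^+ 2 by rewrite !exprMn; lia.
    by rewrite eqf_sqr => /orP[]/eqP Ek; [exists (y - k)|exists (y + k)]; lia.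
  by rewrite Ey mulrCA in Edy; lia.
Qed.

Theorem theorem3 :
  [/\ AP 1 = [set (0, 0, 0); (3, 3, 3); (-15, -6, 3); (3, -6, -15)],
      AP 3 = [set (0, 0, 0); (1, 1, 1); (-5, -2, 1); (1, -2, -5)] &
      forall d : int, 0 < d -> d <> 1 -> d <> 3 -> AP d = [set (0, 0, 0)]].
Proof.
split=> [||d d_gt0 d1 d3]; apply/seteqP; split=> -[[x y] z].
- by move=> /AP_cases[] // => [->|[_ [] ->]|[]] //=; tauto.
- by case=> [[[|]|]|] [-> -> ->].
- by move=> /AP_cases[] // => [->|[]|[_ [] ->]] //=; tauto.
- by case=> [[[|]|]|] [-> -> ->].
- by move=> /(AP_cases d_gt0)[-> //|[]|[]].
- by move=> [-> -> ->]; split; rewrite ?mulr0.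
Qed.
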